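(* Let $G$ be a topological group and let $\Delta=\{(h,h)\in G\times G: h\in G\}$ be the diagonal subgroup. Then the map $$\Theta\colon \Delta\backslash(G\times G)\to G,\qquad \Theta\big(\Delta(g,f)\big)=g^{-1}f,$$ defines a bijective coarse equivalence between $\mathcal E_{\rm Haus}\big(\Delta\backslash(G\times G)\big)$ and $\bigcap_d\mathcal E_{d_\wedge}(G)$, where $d$ ranges over all continuous left-invariant pseudometrics on $G$.
   Context: A coarse structure on a set $X$ is an ideal $\mathcal E$ of subsets of $X\times X$ (closed under subsets and finite unions) containing the diagonal and closed under transposition and composition. A pseudometric $d$ on $X$ induces $\mathcal E_d(X)=\{E\subseteq X\times X:\sup_{(x,y)\in E}d(x,y)<\infty\}$. A map $\phi\colon(X,\mathcal E)\to(Y,\mathcal F)$ is controlled if $(\phi\times\phi)[E]\in\mathcal F$ for all $E\in\mathcal E$. A bijective coarse equivalence is a bijection $\phi$ such that both $\phi$ and $\phi^{-1}$ are controlled. For a subgroup $K$ of a topological group $\Gamma$, $K\backslash\Gamma$ is the set of right cosets $Kg$, and $\mathcal E_{\rm Haus}(K\backslash\Gamma)=\bigcap_D\mathcal E_{D_{\rm Haus}}(K\backslash\Gamma)$, where $D$ ranges over all continuous left-invariant pseudometrics on $\Gamma$ and $D_{\rm Haus}$ is the Hausdorff distance between cosets with respect to $D$, which satisfies $D_{\rm Haus}(Kg,Kf)=\inf_{h\in K}D(hg,f)$; this is applied with $\Gamma=G\times G$ (product topology) and $K=\Delta$. For a continuous left-invariant pseudometric $d$ on $G$, put $\check d(g,f)=d(g^{-1},f^{-1})$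 and $$d_\wedge(g,f)=\inf_{h\in G}\max\{d(g,h),\check d(h,f)\}.$$ For each such $d$, $\mathcal E_{d_\wedge}(G)=\{E\subseteq G\times G:\sup_{(g,f)\in E}d_\wedge(g,f)<\infty\}$ is a coarse structure (it is the coarse structure generated by $\mathcal E_d(G)\cup\mathcal E_{\check d}(G)$). *)

(* Defs.v *)
From HB Require Import structures.
From mathcomp Require Import all_boot all_order all_algebra.
From mathcomp Require Import all_classical all_reals all_analysis.

Set Implicit Arguments.
Unset Strict Implicit.
Unset Printing Implicit Defensive.

Import Order.TTheory GRing.Theory Num.Theory.
Import numFieldNormedType.Exports.

Local Open Scope classical_set_scope.
Local Open Scope ring_scope.

(* No separation axiom is required of a topological group. *)
HB.mixin Record isTopologicalGroup G & Topological G & Group G := {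
  mulg_continuous : continuous (fun x : G * G => (x.1 * x.2)%g);
  invg_continuous : continuous (fun x : G => (x^-1)%g) }.

#[short(type="topologicalGroupType")]
HB.structure Definition TopologicalGroup :=
  {G of Topological G & Group G & isTopologicalGroup G}.

Section ProductGroup.
Variables G H : topologicalGroupType.

Lemma prod_mulg_continuous :
  continuous (fun x : (G * H) * (G * H) => (x.1 * x.2)%g).
Proof.
case=> -[a1 a2] [b1 b2].
apply: (cvg_pair (f := fun y : (G * H) * (G * H) => (y.1.1 * y.2.1)%g)
                 (g := fun y : (G * H) * (G * H) => (y.1.2 * y.2.2)%g)).
- apply: (cvg_comp (fun y : (G * H) * (G * H) => (y.1.1, y.2.1))
    (fun z : G * G => (z.1 * z.2)%g)); last exact: mulg_continuous (a1, b1).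
  apply: cvg_pair.
  + exact: (cvg_comp _ _ cvg_fst cvg_fst).
  + exact: (cvg_comp _ _ cvg_snd cvg_fst).
- apply: (cvg_comp (fun y : (G * H) * (G * H) => (y.1.2, y.2.2))
    (fun z : H * H => (z.1 * z.2)%g)); last exact: mulg_continuous (a2, b2).
  apply: cvg_pair.
  + exact: (cvg_comp _ _ cvg_fst cvg_snd).
  + exact: (cvg_comp _ _ cvg_snd cvg_snd).
Qed.

Lemma prod_invg_continuous : continuous (fun x : G * H => (x^-1)%g).
Proof.
case=> a b.
apply: (cvg_pair (f := fun y : G * H => (y.1^-1)%g)
                 (g := fun y : G * H => (y.2^-1)%g)).
- by apply: (cvg_comp _ _ cvg_fst); exact: invg_continuous.
- by apply: (cvg_comp _ _ cvg_snd); exact: invg_continuous.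
Qed.

HB.instance Definition _ := isTopologicalGroup.Build (G * H)%type
  prod_mulg_continuous prod_invg_continuous.

End ProductGroup.

Record coarse_structure (X : Type) := CoarseStructure {
  coarse_sets : set (set (X * X));
  coarse_subset : forall E F : set (X * X),
    E `<=` F -> coarse_sets F -> coarse_sets E;
  coarse_setU : forall E F : set (X * X),
    coarse_sets E -> coarse_sets F -> coarse_sets (E `|` F);
  coarse_diagonal : coarse_sets diagonal;
  coarse_inv : forall E : set (X * X),
    coarse_sets E -> coarse_sets (E^-1)%relation;
  coarse_comp : forall E F : set (X * X),
    coarse_sets E -> coarse_sets F -> coarse_sets (E \; F)%relation
}.

Section CoarseMaps.
Variables (X Y : Type) (E : coarse_structure X) (F : coarse_structure Y).

Definition controlled (phi : X -> Y) :=
  forall A : set (X * X),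
    coarse_sets E A -> coarse_sets F [set (phi p.1, phi p.2) | p in A].

End CoarseMaps.

Definition bijective_coarse_equivalence (X Y : Type)
    (E : coarse_structure X) (F : coarse_structure Y) (phi : X -> Y) :=
  exists psi : Y -> X,
    [/\ cancel phi psi, cancel psi phi,
        controlled E F phi & controlled F E psi].

Section CoarseBigcap.
Variables (I X : Type) (E : I -> coarse_structure X).

Definition cap_sets : set (set (X * X)) := \bigcap_i coarse_sets (E i).

Lemma cap_subset (A B : set (X * X)) : A `<=` B -> cap_sets B -> cap_sets A.
Proof. by move=> AB cB i _; apply: coarse_subset AB (cB i Logic.I). Qed.

Lemma cap_setU (A B : set (X * X)) :
  cap_sets A -> cap_sets B -> cap_sets (A `|` B).
Proof. by move=> cA cB i _; apply: coarse_setU; [exact: cA|exact: cB]. Qed.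

Lemma cap_diagonal : cap_sets diagonal.
Proof. by move=> i _; exact: coarse_diagonal. Qed.

Lemma cap_inv (A : set (X * X)) : cap_sets A -> cap_sets (A^-1)%relation.
Proof. by move=> cA i _; apply: coarse_inv; exact: cA. Qed.

Lemma cap_comp (A B : set (X * X)) :
  cap_sets A -> cap_sets B -> cap_sets (A \; B)%relation.
Proof. by move=> cA cB i _; apply: coarse_comp; [exact: cA|exact: cB]. Qed.

Definition coarse_bigcap : coarse_structure X :=
  CoarseStructure cap_subset cap_setU cap_diagonal cap_inv cap_comp.

End CoarseBigcap.

Section Pseudometric.
Variable R : realType.

Record pseudometric (X : Type) := Pseudometric {
  pm_fun :> X -> X -> R;
  pm_ge0 : forall x y, 0 <= pm_fun x y;
  pm_refl : forall x, pm_fun x x = 0;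
  pm_sym : forall x y, pm_fun x y = pm_fun y x;
  pm_triangle : forall x y z, pm_fun x z <= pm_fun x y + pm_fun y z
}.

Section MetricCoarse.
Variables (X : Type) (d : pseudometric X).

Definition bounded_sets : set (set (X * X)) :=
  [set E | (ereal_sup [set (d p.1 p.2)%:E | p in E] < +oo)%E].

Lemma boundedP (E : set (X * X)) :
  bounded_sets E <-> exists M, forall x y, E (x, y) -> d x y <= M.
Proof.
split=> [|[M EM]].
- rewrite /bounded_sets /=.
  case: (ereal_sup _) (@ereal_sup_ubound _ [set (d p.1 p.2)%:E | p in E])
    => [s|//|] ub _.
  + by exists s => x y Exy; rewrite -lee_fin; apply: ub; exists (x, y).
  + exists 0 => x y Exy.
    by have /= := ub (d x y)%:E (ex_intro2 _ _ (x, y) Exy erefl).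
- apply: (@le_lt_trans _ _ M%:E); last exact: ltry.
  by apply: ge_ereal_sup => _ [[x y] Exy <-]; rewrite lee_fin; exact: EM.
Qed.

Lemma bounded_subset (E F : set (X * X)) :
  E `<=` F -> bounded_sets F -> bounded_sets E.
Proof.
move=> EF /boundedP[M FM]; apply/boundedP; exists M => x y Exy.
by apply: FM; exact: EF.
Qed.

Lemma bounded_setU (E F : set (X * X)) :
  bounded_sets E -> bounded_sets F -> bounded_sets (E `|` F).
Proof.
move=> /boundedP[M EM] /boundedP[N FN]; apply/boundedP.
exists (Num.max M N) => x y []h; rewrite le_max.
  by rewrite EM.
by rewrite FN// orbT.
Qed.

Lemma bounded_diagonal : bounded_sets diagonal.
Proof. by apply/boundedP; exists 0 => x y /diagonalP ->; rewrite pm_refl. Qed.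

Lemma bounded_inv (E : set (X * X)) :
  bounded_sets E -> bounded_sets (E^-1)%relation.
Proof.
move=> /boundedP[M EM]; apply/boundedP; exists M => x y /= Eyx.
by rewrite pm_sym; exact: EM.
Qed.

Lemma bounded_comp (E F : set (X * X)) :
  bounded_sets E -> bounded_sets F -> bounded_sets (E \; F)%relation.
Proof.
move=> /boundedP[M EM] /boundedP[N FN]; apply/boundedP.
exists (N + M) => x y /= [z h1 h2].
apply: (le_trans (pm_triangle _ _ z _)).
by apply: lerD; [exact: FN|exact: EM].
Qed.

Definition pm_coarse : coarse_structure X :=
  CoarseStructure bounded_subset bounded_setU bounded_diagonal
    bounded_inv bounded_comp.

End MetricCoarse.

(* Extended-real valued, since [A] and [B] are arbitrary subsets. *)
Definition hausdorff_dist (X : Type) (d : X -> X -> R) (A B : set X) : \bar R :=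
  maxe (ereal_sup [set ereal_inf [set (d a b)%:E | b in B] | a in A])
       (ereal_sup [set ereal_inf [set (d a b)%:E | a in A] | b in B]).

Record cont_linv_pseudometric (G : topologicalGroupType) :=
  ContLinvPseudometric {
  lipm :> pseudometric G;
  lipm_continuous : continuous (fun p : G * G => lipm p.1 p.2);
  lipm_invariant : forall h g f : G, lipm (h * g)%g (h * f)%g = lipm g f
}.

End Pseudometric.

Section Cosets.
Variables (G : groupType) (K : groupClosed G).

Definition right_coset (g : G) : set G := [set (h * g)%g | h in [set` K]].

Definition coset_space := set_type (range right_coset).

Definition to_coset (g : G) : coset_space :=
  SigSub (mem_set (imageT right_coset g)).

End Cosets.

Lemma inf_add (R : realType) (A B C : set R) :
  A !=set0 -> B !=set0 -> (forall c, C c -> 0 <= c) ->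
  (forall a b, A a -> B b -> exists2 c, C c & c <= a + b) ->
  inf C <= inf A + inf B.
Proof.
move=> A0 B0 C0 h.
rewrite -lerBlDr; apply: lb_le_inf => // a Aa.
rewrite lerBlDr -lerBlDl; apply: lb_le_inf => // b Bb.
rewrite lerBlDl; have [c Cc cab] := h a b Aa Bb.
by apply: le_trans cab; apply: ge_inf => //; exists 0 => ? /C0.
Qed.

Section Hausdorff.
Variables (R : realType) (G : topologicalGroupType) (K : groupClosed G).
Variable D : cont_linv_pseudometric R G.

Lemma hausdorff_dist_coset (g f : G) :
  hausdorff_dist D (right_coset K g) (right_coset K f)
  = (inf [set D (h * g)%g f | h in [set` K]])%:E.
Proof.
set S := [set D (h * g)%g f | h in [set` K]].
have K1 : [set` K] 1%g by exact: gpred1.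
have SE : ereal_inf [set x%:E | x in S] = (inf S)%:E.
  apply: ereal_inf_EFin; last by exists (D (1 * g)%g f); exists 1%g.
  by exists 0 => _ [h _ <-]; exact: pm_ge0.
have fstE : forall a, right_coset K g a ->
    ereal_inf [set (D a b)%:E | b in right_coset K f] = (inf S)%:E.
  move=> _ [k Kk <-]; rewrite -SE; congr ereal_inf; apply/seteqP; split.
  - move=> _ [_ [l Kl <-] <-]; exists (D (l^-1 * k * g)%g f) => //.
      by exists (l^-1 * k)%g => //=; apply: gpredM => //; exact: gpredVr.
    by rewrite -(lipm_invariant D l) !mulgA mulgV mul1g.
  - move=> _ [_ [h Kh <-] <-]; exists (k * h^-1 * f)%g.
      by exists (k * h^-1)%g => //=; apply: gpredM => //; exact: gpredVr.
    congr EFin; rewrite -(lipm_invariant D (h * k^-1)%g) !mulgA.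
    by rewrite mulgVK mulgV mul1g.
have sndE : forall b, right_coset K f b ->
    ereal_inf [set (D a b)%:E | a in right_coset K g] = (inf S)%:E.
  move=> _ [l Kl <-]; rewrite -SE; congr ereal_inf; apply/seteqP; split.
  - move=> _ [_ [k Kk <-] <-]; exists (D (l^-1 * k * g)%g f) => //.
      by exists (l^-1 * k)%g => //=; apply: gpredM => //; exact: gpredVr.
    by rewrite -(lipm_invariant D l) !mulgA mulgV mul1g.
  - move=> _ [_ [h Kh <-] <-]; exists (l * h * g)%g.
      by exists (l * h)%g => //=; apply: gpredM.
    by congr EFin; rewrite -mulgA lipm_invariant.
rewrite /hausdorff_dist (eq_imagel fstE) (eq_imagel sndE).
have ne x : right_coset K x !=set0 by exists (1 * x)%g; exists 1%g.
by rewrite !ereal_sup_cst ?maxxx//; apply/set0P; exact: ne.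
Qed.

(* [fine] loses nothing, by [hausdorff_dist_coset]. *)
Definition coset_hausdorff (A B : coset_space K) : R :=
  fine (hausdorff_dist D (val A) (val B)).

Lemma coset_hausdorffE g f :
  coset_hausdorff (to_coset K g) (to_coset K f)
  = inf [set D (h * g)%g f | h in [set` K]].
Proof. by rewrite /coset_hausdorff hausdorff_dist_coset. Qed.

Lemma to_coset_surj (A : coset_space K) : exists g, A = to_coset K g.
Proof.
by case: A => A hA; have [g _ gA] := set_mem hA; exists g; exact/val_inj.
Qed.

Let K1 : [set` K] 1%g. Proof. exact: gpred1. Qed.

Lemma haus_ge0 A B : 0 <= coset_hausdorff A B.
Proof.
have [g ->] := to_coset_surj A; have [f ->] := to_coset_surj B.
rewrite coset_hausdorffE.
apply: lb_le_inf.
  by exists (D (1 * g)%g f); exists 1%g.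
by move=> _ [h _ <-]; exact: pm_ge0.
Qed.

Lemma haus_refl A : coset_hausdorff A A = 0.
Proof.
apply/eqP; rewrite eq_le haus_ge0 andbT; have [g ->] := to_coset_surj A.
rewrite coset_hausdorffE; apply: ge_inf.
  by exists 0 => _ [h _ <-]; exact: pm_ge0.
by exists 1%g => //; rewrite mul1g pm_refl.
Qed.

Lemma haus_sym A B : coset_hausdorff A B = coset_hausdorff B A.
Proof.
rewrite /coset_hausdorff /hausdorff_dist maxC; congr fine; congr maxe;
  congr ereal_sup;
  apply: eq_imagel => a _; congr ereal_inf; apply: eq_imagel => b _;
  by rewrite pm_sym.
Qed.

Lemma haus_triangle A B C :
  coset_hausdorff A C <= coset_hausdorff A B + coset_hausdorff B C.
Proof.
have [g ->] := to_coset_surj A; have [f ->] := to_coset_surj B.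
have [e ->] := to_coset_surj C.
rewrite !coset_hausdorffE; apply: inf_add.
- by exists (D (1 * g)%g f); exists 1%g.
- by exists (D (1 * f)%g e); exists 1%g.
- by move=> _ [h _ <-]; exact: pm_ge0.
move=> _ _ [h Kh <-] [k Kk <-]; exists (D (k * h * g)%g e).
  by exists (k * h)%g => //; exact: gpredM.
by rewrite -(lipm_invariant D k (h * g)%g) mulgA; exact: pm_triangle.
Qed.

Definition hausdorff_pm : pseudometric R (coset_space K) :=
  Pseudometric haus_ge0 haus_refl haus_sym haus_triangle.

End Hausdorff.

Definition hausdorff_coarse (R : realType) (G : topologicalGroupType)
    (K : groupClosed G) : coarse_structure (coset_space K) :=
  coarse_bigcap (fun D : cont_linv_pseudometric R G =>
    pm_coarse (hausdorff_pm K D)).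

Section Wedge.
Variables (R : realType) (G : topologicalGroupType).
Variable d : cont_linv_pseudometric R G.

Definition check_dist (g f : G) : R := d (g^-1)%g (f^-1)%g.

Definition wedge_dist (g f : G) : R :=
  inf [set Num.max (d g h) (check_dist h f) | h in [set: G]].

Lemma wedge_ge0 g f : 0 <= wedge_dist g f.
Proof.
apply: lb_le_inf.
  by exists (Num.max (d g 1%g) (check_dist 1%g f)); exists 1%g.
by move=> _ [h _ <-]; rewrite le_max pm_ge0.
Qed.

Lemma wedge_has_lb g f :
  has_lbound [set Num.max (d g h) (check_dist h f) | h in [set: G]].
Proof. by exists 0 => _ [h _ <-]; rewrite le_max pm_ge0. Qed.

Lemma wedge_refl g : wedge_dist g g = 0.
Proof.
apply/eqP; rewrite eq_le wedge_ge0 andbT; apply: ge_inf.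
  exact: wedge_has_lb.
by exists g => //; rewrite /check_dist !pm_refl maxxx.
Qed.

(* Left translations preserve [d], right translations preserve [check_dist]:
   the two steps of a path can therefore be exchanged. *)
Lemma wedge_swap (g h f : G) : exists k,
  d f k = d g h /\ check_dist k g = check_dist h f.
Proof.
exists (f * h^-1 * g)%g; split.
- rewrite -(lipm_invariant d (h * f^-1)%g) !mulgA.
  by rewrite !mulgVK mulgV mul1g pm_sym.
- rewrite /check_dist !invgM invgK -(lipm_invariant d g) !mulgA.
  rewrite mulgV mul1g -(lipm_invariant d h^-1)%g !mulgA mulVg mul1g mulg1.
  by rewrite pm_sym.
Qed.

Lemma wedge_le g f : wedge_dist g f <= wedge_dist f g.
Proof.
apply: lb_le_inf.
  by exists (Num.max (d f 1%g) (check_dist 1%g g)); exists 1%g.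
move=> _ [h _ <-]; have [k [<- <-]] := wedge_swap f h g.
by apply: ge_inf; [exact: wedge_has_lb|exists k].
Qed.

Lemma wedge_sym g f : wedge_dist g f = wedge_dist f g.
Proof. by apply/eqP; rewrite eq_le !wedge_le. Qed.

Lemma wedge_triangle g f e : wedge_dist g e <= wedge_dist g f + wedge_dist f e.
Proof.
apply: inf_add.
- by exists (Num.max (d g 1%g) (check_dist 1%g f)); exists 1%g.
- by exists (Num.max (d f 1%g) (check_dist 1%g e)); exists 1%g.
- by move=> _ [h _ <-]; rewrite le_max pm_ge0.
move=> _ _ [h _ <-] [k _ <-].
have [l [dl cl]] := wedge_swap k f h.
exists (Num.max (d g l) (check_dist l e)); first by exists l.
rewrite ge_max; apply/andP; split.
- apply: (le_trans (pm_triangle d g h l)); apply: lerD; rewrite le_max ?lexx//.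
  by rewrite dl pm_sym lexx.
- apply: (le_trans (pm_triangle d (l^-1)%g (k^-1)%g (e^-1)%g)).
  apply: lerD; rewrite le_max.
    by rewrite -/(check_dist l k) cl /check_dist pm_sym lexx orbT.
  by rewrite -/(check_dist k e) lexx orbT.
Qed.

Definition wedge_pm : pseudometric R G :=
  Pseudometric wedge_ge0 wedge_refl wedge_sym wedge_triangle.

End Wedge.

Definition wedge_coarse (R : realType) (G : topologicalGroupType) :
    coarse_structure G :=
  coarse_bigcap (fun d : cont_linv_pseudometric R G =>
    pm_coarse (wedge_pm d)).

Section DiagonalSubgroup.
Variable G : groupType.

Definition diagonal_subgroup : {pred G * G} := fun x => x.1 == x.2.

Lemma diagonal_mul : mulg_closed diagonal_subgroup.
Proof. by move=> [a b] [c e] /eqP /= <- /eqP /= <-; exact: eqxx. Qed.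

Lemma diagonal_one : 1%g \in diagonal_subgroup.
Proof. exact: eqxx. Qed.

Lemma diagonal_invg : invg_closed diagonal_subgroup.
Proof. by move=> [a b] /eqP /= <-; exact: eqxx. Qed.

HB.instance Definition _ := isMulClosed.Build (G * G)%type
  diagonal_subgroup diagonal_mul.
HB.instance Definition _ := isMul1Closed.Build (G * G)%type
  diagonal_subgroup diagonal_one.
HB.instance Definition _ := isInvClosed.Build (G * G)%type
  diagonal_subgroup diagonal_invg.

End DiagonalSubgroup.

Arguments diagonal_subgroup : clear implicits.

(* Main.v *)
(* Write an element of [G * G] modulo the diagonal as the coset of [(1, x)].
   Its Hausdorff distance to the coset of [(1, y)] for the pseudometric
   [max (d a a') (d b b')] is the infimum over [h] of
   [max (d h 1) (d (h * x) y)], and the substitution [k = h^-1 * y] turns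
   this into [wedge_dist d x y].
   Conversely any left-invariant [D] on [G * G] satisfies
   [D (a, b) (a', b') <= D (a, 1) (a', 1) + D (1, b) (1, b')], so it is
   dominated by twice such a maximum. *)
Require Import Defs.
From HB Require Import structures.
From mathcomp Require Import all_boot all_order all_algebra.
From mathcomp Require Import all_classical all_reals all_analysis.

Set Implicit Arguments.
Unset Strict Implicit.
Unset Printing Implicit Defensive.

Import Order.TTheory GRing.Theory Num.Theory.
Import numFieldNormedType.Exports.

Local Open Scope classical_set_scope.
Local Open Scope ring_scope.

Lemma mulg_pair (G H : groupType) (a c : G) (b e : H) :
  ((a, b) * (c, e))%g = ((a * c)%g, (b * e)%g).
Proof. by []. Qed.

(** * Pseudometrics obtained by pullback and by maximum *)

Section PullbackPseudometric.
Variables (R : realType) (G H : topologicalGroupType) (phi : G -> H).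
Hypothesis phi_continuous : continuous phi.
Hypothesis phi_morph : {morph phi : x y / (x * y)%g}.
Variable d : cont_linv_pseudometric R H.

Let pull x y := d (phi x) (phi y).

Let pull_ge0 x y : 0 <= pull x y. Proof. exact: pm_ge0. Qed.
Let pull_refl x : pull x x = 0. Proof. exact: pm_refl. Qed.
Let pull_sym x y : pull x y = pull y x. Proof. exact: pm_sym. Qed.
Let pull_triangle x y z : pull x z <= pull x y + pull y z.
Proof. exact: pm_triangle. Qed.

Let pull_continuous : continuous (fun p : G * G => pull p.1 p.2).
Proof.
move=> p; apply: (cvg_comp (fun q : G * G => (phi q.1, phi q.2))
  (fun q : H * H => d q.1 q.2)); last exact: lipm_continuous (phi p.1, phi p.2).
apply: cvg_pair.
- by apply: (cvg_comp _ _ cvg_fst); exact: phi_continuous.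
- by apply: (cvg_comp _ _ cvg_snd); exact: phi_continuous.
Qed.

Let pull_invariant h x y : pull (h * x)%g (h * y)%g = pull x y.
Proof. by rewrite /pull !phi_morph lipm_invariant. Qed.

Definition pullback_lipm : cont_linv_pseudometric R G :=
  @ContLinvPseudometric R G
    (Pseudometric pull_ge0 pull_refl pull_sym pull_triangle)
    pull_continuous pull_invariant.

End PullbackPseudometric.

Section MaxPseudometric.
Variables (R : realType) (G : topologicalGroupType).
Variables d e : cont_linv_pseudometric R G.

Let mx x y := Num.max (d x y) (e x y).

Let mx_ge0 x y : 0 <= mx x y. Proof. by rewrite le_max pm_ge0. Qed.
Let mx_refl x : mx x x = 0. Proof. by rewrite /mx !pm_refl maxxx. Qed.
Let mx_sym x y : mx x y = mx y x.
Proof. by rewrite /mx (pm_sym d) (pm_sym e). Qed.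

Let mx_triangle x y z : mx x z <= mx x y + mx y z.
Proof.
rewrite {1}/mx ge_max; apply/andP; split.
- by apply: (le_trans (pm_triangle d x y z)); apply: lerD; rewrite le_max lexx.
- apply: (le_trans (pm_triangle e x y z)).
  by apply: lerD; rewrite le_max lexx orbT.
Qed.

Let mx_continuous : continuous (fun p : G * G => mx p.1 p.2).
Proof.
move=> p; apply: (continuous_max (f := fun q : G * G => d q.1 q.2)
  (g := fun q : G * G => e q.1 q.2)); exact: lipm_continuous.
Qed.

Let mx_invariant h x y : mx (h * x)%g (h * y)%g = mx x y.
Proof. by rewrite /mx !lipm_invariant. Qed.

Definition max_lipm : cont_linv_pseudometric R G :=
  @ContLinvPseudometric R G
    (Pseudometric mx_ge0 mx_refl mx_sym mx_triangle)
    mx_continuous mx_invariant.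

End MaxPseudometric.

(** * Passing between pseudometrics on [G] and on [G * G] *)

Section ProductPseudometrics.
Variables (R : realType) (G : topologicalGroupType).

Let fst_continuous : continuous (fst : G * G -> G).
Proof. by move=> p; exact: cvg_fst. Qed.

Let snd_continuous : continuous (snd : G * G -> G).
Proof. by move=> p; exact: cvg_snd. Qed.

Let inl_continuous : continuous (fun x : G => (x, 1%g : G)).
Proof. by move=> x; apply: cvg_pair; [exact: cvg_id|exact: cvg_cst]. Qed.

Let inr_continuous : continuous (fun x : G => (1%g : G, x)).
Proof. by move=> x; apply: cvg_pair; [exact: cvg_cst|exact: cvg_id]. Qed.

Let inl_morph : {morph (fun x : G => (x, 1%g : G)) : x y / (x * y)%g}.
Proof. by move=> x y; congr pair; rewrite mul1g. Qed.

Let inr_morph : {morph (fun x : G => (1%g : G, x)) : x y / (x * y)%g}.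
Proof. by move=> x y; congr pair; rewrite mul1g. Qed.

Definition prod_lipm (d : cont_linv_pseudometric R G) :
    cont_linv_pseudometric R (G * G)%type :=
  max_lipm (pullback_lipm fst_continuous (fun _ _ => erefl) d)
           (pullback_lipm snd_continuous (fun _ _ => erefl) d).

(** This is the pseudometric on [G] whose wedge distance will control the Hausdorff distance of
    [D]. *)
Definition axes_lipm (D : cont_linv_pseudometric R (G * G)%type) :
    cont_linv_pseudometric R G :=
  max_lipm (pullback_lipm inl_continuous inl_morph D)
           (pullback_lipm inr_continuous inr_morph D).

Lemma le_prod_axes_lipm (D : cont_linv_pseudometric R (G * G)%type) p q :
  D p q <= 2 * prod_lipm (axes_lipm D) p q.
Proof.
case: p q => [a b] [a' b'].
(* Change one coordinate at a time; in each step the common coordinate is then translated to 1. Each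
   of the two steps is at most the maximum, whence the factor 2. *)
apply: (le_trans (pm_triangle D _ (a', b) _)).
rewrite -(lipm_invariant D (1%g, b^-1)%g).
rewrite -(lipm_invariant D (a'^-1, 1)%g (a', b)).
rewrite mulr_natl mulr2n; apply: lerD; rewrite /= !le_max.
- by rewrite !mulg_pair !mul1g mulVg lexx.
- by rewrite !mulg_pair !mul1g mulVg lexx !orbT.
Qed.

End ProductPseudometrics.

(** * Hausdorff distances between cosets of the diagonal *)

Section DiagonalCosets.
Variables (R : realType) (G : topologicalGroupType).

Local Notation K := (diagonal_subgroup G).

(** The diagonal element [(g^-1, g^-1)] carries [(g, f)] to the second representative. *)
Lemma to_coset_diagonal (g f : G) :
  to_coset K (g, f) = to_coset K (1%g, (g^-1 * f)%g).
Proof.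
apply: val_inj; apply/seteqP; split=> _ [[h k] /eqP /= <- <-].
- exists (h * g, h * g)%g; first exact: eqxx.
  by congr pair; rewrite ?mulg1 ?mulgA ?mulgK.
- exists (h * g^-1, h * g^-1)%g; first exact: eqxx.
  by congr pair; rewrite ?mulgVK ?mulg1 ?mulgA.
Qed.

Lemma coset_hausdorff_diagonal (D : cont_linv_pseudometric R (G * G)%type) x y :
  coset_hausdorff D (to_coset K (1%g, x)) (to_coset K (1%g, y)) =
  inf [set D (h, h * x)%g (1%g, y) | h in [set: G]].
Proof.
rewrite coset_hausdorffE; congr inf; apply/seteqP; split.
- by move=> _ [[h k] /eqP /= <- <-]; exists h => //; rewrite mulg_pair mulg1.
- move=> _ [h _ <-]; exists (h, h); first exact: eqxx.
  by rewrite mulg_pair mulg1.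
Qed.

Lemma coset_hausdorff_prod (d : cont_linv_pseudometric R G) x y :
  coset_hausdorff (prod_lipm d) (to_coset K (1%g, x)) (to_coset K (1%g, y)) =
  wedge_dist d x y.
Proof.
(* Translating by [h^-1] treats [d (h * x) y]; translating by [y^-1] turns [d h 1] into the
   [check_dist] term. *)
have dE h : prod_lipm d (h, h * x)%g (1%g, y) =
    Num.max (d x (h^-1 * y)%g) (check_dist d (h^-1 * y)%g y).
  rewrite /= maxC /check_dist invgM invgK; congr Num.max.
  - by rewrite -(lipm_invariant d h^-1%g) mulKg.
  - by rewrite -(lipm_invariant d y^-1%g) mulg1.
rewrite coset_hausdorff_diagonal; congr inf; apply/seteqP; split.
- by move=> _ [h _ <-]; exists (h^-1 * y)%g.
(* Solve [k = h^-1 * y] for [h]. *)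
- move=> _ [k _ <-]; exists (y * k^-1)%g => //.
  by rewrite dE invgM invgK mulgVK.
Qed.

Lemma coset_hausdorff_le_wedge (D : cont_linv_pseudometric R (G * G)%type) x y :
  coset_hausdorff D (to_coset K (1%g, x)) (to_coset K (1%g, y)) <=
  2 * wedge_dist (axes_lipm D) x y.
Proof.
(* Both sides become infima over the same [h], so the pointwise bound [le_prod_axes_lipm]
   suffices. *)
rewrite -coset_hausdorff_prod !coset_hausdorff_diagonal -ler_pdivrMl//.
apply: lb_le_inf.
  by exists (prod_lipm (axes_lipm D) (1, 1 * x)%g (1%g, y)), 1%g.
move=> _ [h _ <-]; rewrite ler_pdivrMl//.
apply: le_trans (le_prod_axes_lipm _ _ _).
by apply: ge_inf; [exists 0 => _ [? _ <-]; exact: pm_ge0|exists h].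
Qed.

End DiagonalCosets.

Theorem theorem5 (R : realType) (G : topologicalGroupType) :
  exists Theta : coset_space (diagonal_subgroup G) -> G,
    (forall g f : G,
       Theta (to_coset (diagonal_subgroup G) (g, f)) = (g^-1 * f)%g) /\
    bijective_coarse_equivalence
      (hausdorff_coarse R (diagonal_subgroup G)) (wedge_coarse R G) Theta.
Proof.
pose psi x : coset_space (diagonal_subgroup G) := to_coset _ (1%g, x).
have psi_inj : injective psi.
  (* [(1, x)] lies in the coset of [(1, y)], and its first coordinate forces the diagonal factor to
     be 1. *)
  move=> x y /(congr1 val) /= /seteqP[+ _].
  move=> /(_ (1 * (1, x))%g (ex_intro2 _ _ 1%g (eqxx _) erefl)).
  case=> -[h k] /eqP /= <-.
  by rewrite !mulg_pair !mul1g mulg1 => -[-> ]; rewrite mul1g.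
have psi_surj A : exists x, A = psi x.
  have [[g f] ->] := to_coset_surj A.
  by exists (g^-1 * f)%g; exact: to_coset_diagonal.
(* [phi] is chosen as a right inverse of [psi], which avoids checking independence of
   representatives; injectivity of [psi] makes it two-sided and so determines it. *)
have [phi psiK] := boolp.choice psi_surj.
have phiK : cancel psi phi by move=> x; apply: psi_inj; rewrite -psiK.
exists phi; split=> [g f|]; first by rewrite to_coset_diagonal phiK.
exists psi; split=> //.
(* The Hausdorff distance for [prod_lipm d] equals the wedge distance of [d], so the same [M]
   works. *)
- move=> A cA d _; have /boundedP[M AM] := cA (prod_lipm d) Logic.I.
  apply/boundedP; exists M => _ _ [[a b] Aab [<- <-]] /=.
  by rewrite -coset_hausdorff_prod -/(psi _) -/(psi (phi b)) -!psiK; exact: AM.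
(* Here there is only domination up to the factor 2, which boundedness tolerates. *)
- move=> A cA D _; have /boundedP[M AM] := cA (axes_lipm D) Logic.I.
  apply/boundedP; exists (2 * M) => _ _ [[x y] Axy [<- <-]] /=.
  apply: (le_trans (coset_hausdorff_le_wedge D x y)).
  by rewrite ler_pM2l//; exact: AM.
Qed.
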